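(* Let $A,B,C$ be simple types, let $M$ be a closed $\lambda$-term of type $A\times B\Rightarrow C$, and let $L_C\subseteq\mathrm{Tm}(C)$ be a regular language. For regular languages $L_A\subseteq\mathrm{Tm}(A)$ and $L_B\subseteq\mathrm{Tm}(B)$ define $$L_A\backslash L_C=\{\,N_B\in\mathrm{Tm}(B)\mid \forall N_A\in L_A,\ M\,(N_A,N_B)\in L_C\,\},$$ $$L_C/ L_B=\{\,N_A\in\mathrm{Tm}(A)\mid \forall N_B\in L_B,\ M\,(N_A,N_B)\in L_C\,\}.$$ Then $L_A\backslash L_C$ and $L_C/L_B$ are regular, and the maps $L_A\mapsto L_A\backslash L_C$ from $\mathrm{Reg}(A)$ to $\mathrm{Reg}(B)^{\mathrm{op}}$ and $L_B\mapsto L_C/L_B$ from $\mathrm{Reg}(B)^{\mathrm{op}}$ to $\mathrm{Reg}(A)$ form an adjunction (left adjoint the former), i.e. for all $L_A\in\mathrm{Reg}(A)$ and $L_B\in\mathrm{Reg}(B)$: $L_B\subseteq L_A\backslash L_C$ if and only if $L_A\subseteq L_C/L_B$.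
   Context: Simple types: $A,B::=A\times B\mid A\Rightarrow B\mid 1\mid o$. $\mathrm{Tm}(A)$: closed simply-typed $\lambda$-terms (with pairs, projections, unit) of type $A$ modulo $\beta\eta$. For a finite set $Q$, $[\![-]\!]_Q$ is the standard interpretation in finite sets with $[\![o]\!]_Q=Q$. $L\subseteq\mathrm{Tm}(A)$ is $Q$-regular if $L=\{N\mid[\![N]\!]_Q\in F\}$ for some $F\subseteq[\![A]\!]_Q$, and regular if $Q$-regular for some finite $Q$. $\mathrm{Reg}(A)$ is the set of regular languages of type $A$ ordered by inclusion. *)

(* Defs.v *)
From HB Require Import structures.
From mathcomp Require Import all_boot all_order.
From mathcomp Require Import boolp classical_sets.
Set Implicit Arguments.
Unset Strict Implicit.
Unset Printing Implicit Defensive.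

Local Open Scope classical_set_scope.
Local Open Scope quotient_scope.

Inductive ty : Type :=
| Prod of ty & ty
| Arr of ty & ty
| Unit
| Base.

Definition ctx := seq ty.

(* Intrinsically typed terms, with de Bruijn indices as typed variables. *)
Inductive var : ctx -> ty -> Type :=
| VZ G A : var (A :: G) A
| VS G A B : var G A -> var (B :: G) A.

Inductive term : ctx -> ty -> Type :=
| Var G A : var G A -> term G A
| Lam G A B : term (A :: G) B -> term G (Arr A B)
| App G A B : term G (Arr A B) -> term G A -> term G B
| Pair G A B : term G A -> term G B -> term G (Prod A B)
| Fst G A B : term G (Prod A B) -> term G A
| Snd G A B : term G (Prod A B) -> term G B
| Star G : term G Unit.

Arguments VZ {G A}.
Arguments VS {G A B} _.
Arguments Star {G}.

Definition var_nil (T : ty -> Type) A (x : var [::] A) : T A :=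
  match x in var G A return (if G is [::] then T A else unit) with
  | VZ _ _ => tt
  | VS _ _ _ _ => tt
  end.

Definition var_cons (T : ty -> Type) G B (b : T B) (f : forall A, var G A -> T A)
    A (x : var (B :: G) A) : T A :=
  match x in var D A
    return (if D is B' :: G' then T B' -> (forall A, var G' A -> T A) -> T A
            else unit) with
  | VZ _ _ => fun b _ => b
  | VS _ _ _ y => fun _ f => f _ y
  end b f.

Definition ren (G D : ctx) := forall A, var G A -> var D A.
Definition sub (G D : ctx) := forall A, var G A -> term D A.

Definition ren_up G D B (r : ren G D) : ren (B :: G) (B :: D) :=
  var_cons (T := var (B :: D)) VZ (fun A x => VS (r A x)).

Fixpoint rename G A (M : term G A) : forall D, ren G D -> term D A :=
  match M with
  | Var _ _ x => fun D r => Var (r _ x)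
  | Lam _ _ _ M => fun D r => Lam (rename M (ren_up r))
  | App _ _ _ M N => fun D r => App (rename M r) (rename N r)
  | Pair _ _ _ M N => fun D r => Pair (rename M r) (rename N r)
  | Fst _ _ _ M => fun D r => Fst (rename M r)
  | Snd _ _ _ M => fun D r => Snd (rename M r)
  | Star _ => fun D r => Star
  end.

Definition weaken G A B (M : term G A) : term (B :: G) A :=
  rename M (fun _ x => VS x).

Definition sub_up G D B (s : sub G D) : sub (B :: G) (B :: D) :=
  var_cons (T := term (B :: D)) (Var VZ) (fun A x => weaken B (s A x)).

Fixpoint subst G A (M : term G A) : forall D, sub G D -> term D A :=
  match M with
  | Var _ _ x => fun D s => s _ x
  | Lam _ _ _ M => fun D s => Lam (subst M (sub_up s))
  | App _ _ _ M N => fun D s => App (subst M s) (subst N s)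
  | Pair _ _ _ M N => fun D s => Pair (subst M s) (subst N s)
  | Fst _ _ _ M => fun D s => Fst (subst M s)
  | Snd _ _ _ M => fun D s => Snd (subst M s)
  | Star _ => fun D s => Star
  end.

Definition subst1 G A B (M : term (A :: G) B) (N : term G A) : term G B :=
  subst M (var_cons (T := term G) N (fun _ x => Var x)).

Inductive conv : forall G A, term G A -> term G A -> Prop :=
| conv_refl G A (M : term G A) : conv M M
| conv_sym G A (M N : term G A) : conv M N -> conv N M
| conv_trans G A (M N P : term G A) : conv M N -> conv N P -> conv M P
| conv_lam G A B (M M' : term (A :: G) B) : conv M M' -> conv (Lam M) (Lam M')
| conv_app G A B (M M' : term G (Arr A B)) (N N' : term G A) :
    conv M M' -> conv N N' -> conv (App M N) (App M' N')
| conv_pair G A B (M M' : term G A) (N N' : term G B) :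
    conv M M' -> conv N N' -> conv (Pair M N) (Pair M' N')
| conv_fst G A B (M M' : term G (Prod A B)) : conv M M' -> conv (Fst M) (Fst M')
| conv_snd G A B (M M' : term G (Prod A B)) : conv M M' -> conv (Snd M) (Snd M')
| beta_arr G A B (M : term (A :: G) B) (N : term G A) :
    conv (App (Lam M) N) (subst1 M N)
| beta_fst G A B (M : term G A) (N : term G B) : conv (Fst (Pair M N)) M
| beta_snd G A B (M : term G A) (N : term G B) : conv (Snd (Pair M N)) N
| eta_arr G A B (M : term G (Arr A B)) :
    conv (Lam (App (weaken A M) (Var VZ))) M
| eta_prod G A B (M : term G (Prod A B)) : conv (Pair (Fst M) (Snd M)) M
| eta_unit G (M : term G Unit) : conv Star M.

HB.instance Definition _ (G : ctx) (A : ty) := gen_eqMixin (term G A).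
HB.instance Definition _ (G : ctx) (A : ty) := gen_choiceMixin (term G A).

Definition convb A (M N : term [::] A) : bool := `[< conv M N >].

Lemma convb_refl A : reflexive (@convb A).
Proof. by move=> M; apply/asboolP; exact: conv_refl. Qed.

Lemma convb_sym A : symmetric (@convb A).
Proof. by move=> M N; apply/asboolP/asboolP; exact: conv_sym. Qed.

Lemma convb_trans A : transitive (@convb A).
Proof.
move=> N M P /asboolP h1 /asboolP h2; apply/asboolP; exact: conv_trans h1 h2.
Qed.

Canonical convb_equiv A :=
  EquivRel (@convb A) (@convb_refl A) (@convb_sym A) (@convb_trans A).

Definition Tm (A : ty) : Type := {eq_quot (convb_equiv A)}.
HB.instance Definition _ (A : ty) := EqQuotient.on (Tm A).

Lemma Tm_eqP A (M N : term [::] A) : \pi_(Tm A) M = \pi_(Tm A) N <-> conv M N.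
Proof. by split=> [/eqmodP/asboolP //|h]; apply/eqmodP/asboolP. Qed.

Lemma repr_conv A (M : term [::] A) : conv (repr (\pi_(Tm A) M)) M.
Proof. by apply/Tm_eqP; rewrite reprK. Qed.

Definition Tm_app A B (M : Tm (Arr A B)) (N : Tm A) : Tm B :=
  \pi_(Tm B) (App (repr M) (repr N)).

Definition Tm_pair A B (M : Tm A) (N : Tm B) : Tm (Prod A B) :=
  \pi_(Tm (Prod A B)) (Pair (repr M) (repr N)).

Lemma Tm_app_pi A B (M : term [::] (Arr A B)) (N : term [::] A) :
  Tm_app (\pi_(Tm (Arr A B)) M) (\pi_(Tm A) N) = \pi_(Tm B) (App M N).
Proof. by apply/Tm_eqP/conv_app; exact: repr_conv. Qed.

Lemma Tm_pair_pi A B (M : term [::] A) (N : term [::] B) :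
  Tm_pair (\pi_(Tm A) M) (\pi_(Tm B) N) = \pi_(Tm (Prod A B)) (Pair M N).
Proof. by apply/Tm_eqP/conv_pair; exact: repr_conv. Qed.

Section Interpretation.
Variable Q : finType.

Fixpoint ty_sem (A : ty) : finType :=
  match A with
  | Prod A B => (ty_sem A * ty_sem B)%type
  | Arr A B => {ffun ty_sem A -> ty_sem B}
  | Unit => unit
  | Base => Q
  end.

Definition env (G : ctx) := forall A, var G A -> ty_sem A.

Definition env_cons G B (b : ty_sem B) (e : env G) : env (B :: G) :=
  var_cons (T := fun A => ty_sem A) b e.

Fixpoint term_sem G A (M : term G A) : env G -> ty_sem A :=
  match M in term G A return env G -> ty_sem A with
  | Var _ _ x => fun e => e _ x
  | Lam _ A B M => fun e => [ffun a : ty_sem A => term_sem M (env_cons a e)]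
  | App _ A B M N => fun e =>
      (term_sem M e : {ffun ty_sem A -> ty_sem B}) (term_sem N e)
  | Pair _ A B M N => fun e => (term_sem M e, term_sem N e)
  | Fst _ A B M => fun e => (term_sem M e : ty_sem A * ty_sem B).1
  | Snd _ A B M => fun e => (term_sem M e : ty_sem A * ty_sem B).2
  | Star _ => fun e => tt
  end.

Lemma var_consP (P : forall G A, var G A -> Prop) :
  (forall G A, P (A :: G) A VZ) -> (forall G A B (x : var G A), P (B :: G) A (VS x)) ->
  forall G A (x : var G A), P G A x.
Proof. by move=> hz hs G A []. Qed.

Lemma env_ext G (e e' : env G) : (forall A (x : var G A), e A x = e' A x) -> e = e'.
Proof. by move=> h; apply: functional_extensionality_dep => A; apply: funext. Qed.

Lemma var_cons_ext (T : ty -> Type) G B (f g : forall A, var (B :: G) A -> T A) :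
  f B VZ = g B VZ -> (forall A (x : var G A), f A (VS x) = g A (VS x)) ->
  forall A (x : var (B :: G) A), f A x = g A x.
Proof.
move=> hz hs A x.
pose R D (A : ty) : var D A -> Prop :=
  match D with
  | [::] => fun _ => True
  | B' :: G' => fun x => forall f g : forall A, var (B' :: G') A -> T A,
      f B' VZ = g B' VZ -> (forall A (y : var G' A), f A (VS y) = g A (VS y)) ->
      f A x = g A x
  end.
suff h : R (B :: G) A x by exact: h.
by apply: (@var_consP R) => /= [G' A'|G' A' B' y] f' g' hz' hs'.
Qed.

Lemma term_sem_rename G A (M : term G A) D (r : ren G D) (e : env D) :
  term_sem (rename M r) e = term_sem M (fun B x => e B (r B x)).
Proof.
elim: M D r e => //=.
- move=> {}G {}A B M IH D r e; apply/ffunP => a; rewrite !ffunE IH.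
  by congr term_sem; apply: env_ext; apply: var_cons_ext.
- by move=> {}G {}A B M IHM N IHN D r e; rewrite IHM IHN.
- by move=> {}G {}A B M IHM N IHN D r e; rewrite IHM IHN.
- by move=> {}G {}A B M IHM D r e; rewrite IHM.
- by move=> {}G {}A B M IHM D r e; rewrite IHM.
Qed.

Lemma term_sem_subst G A (M : term G A) D (s : sub G D) (e : env D) :
  term_sem (subst M s) e = term_sem M (fun B x => term_sem (s B x) e).
Proof.
elim: M D s e => //=.
- move=> {}G {}A B M IH D s e; apply/ffunP => a; rewrite !ffunE IH.
  congr term_sem; apply: env_ext; apply: var_cons_ext => //= C x.
  by rewrite /weaken term_sem_rename.
- by move=> {}G {}A B M IHM N IHN D s e; rewrite IHM IHN.
- by move=> {}G {}A B M IHM N IHN D s e; rewrite IHM IHN.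
- by move=> {}G {}A B M IHM D s e; rewrite IHM.
- by move=> {}G {}A B M IHM D s e; rewrite IHM.
Qed.

Lemma term_sem_conv G A (M N : term G A) (e : env G) :
  conv M N -> term_sem M e = term_sem N e.
Proof.
move=> h; elim: h e => //=.
- by move=> {M N}G0 A0 M N P _ h1 _ h2 e; rewrite h1.
- by move=> G0 A0 B M0 M' _ IH e; apply/ffunP => a; rewrite !ffunE IH.
- by move=> G0 A0 B M0 M' N0 N' _ IHM _ IHN e; rewrite IHM IHN.
- by move=> G0 A0 B M0 M' N0 N' _ IHM _ IHN e; rewrite IHM IHN.
- by move=> G0 A0 B M0 M' _ IH e; rewrite IH.
- by move=> G0 A0 B M0 M' _ IH e; rewrite IH.
- move=> G0 A0 B M0 N0 e; rewrite ffunE /subst1 term_sem_subst.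
  by congr term_sem; apply: env_ext; apply: var_cons_ext.
- by move=> G0 A0 B M0 e; apply/ffunP => a; rewrite ffunE /weaken term_sem_rename.
- by move=> G0 A0 B M0 e; rewrite -surjective_pairing.
- by move=> G0 M0 e; case: (term_sem M0 e).
Qed.

Definition closed_sem A (M : term [::] A) : ty_sem A :=
  term_sem M (var_nil ty_sem).

Definition Tm_sem A (M : Tm A) : ty_sem A := closed_sem (repr M).

Lemma Tm_sem_pi A (M : term [::] A) : Tm_sem (\pi_(Tm A) M) = closed_sem M.
Proof. exact/term_sem_conv/repr_conv. Qed.

End Interpretation.

Definition Q_regular (Q : finType) A (L : set (Tm A)) : Prop :=
  exists F : {set ty_sem Q A}, L = [set N | Tm_sem Q N \in F].

Definition regular A (L : set (Tm A)) : Prop :=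
  exists Q : finType, Q_regular Q L.

Record Reg A := MkReg { lang :> set (Tm A); _ : `[< regular lang >] }.
HB.instance Definition _ A := [isSub for @lang A].
HB.instance Definition _ A := [Choice of Reg A by <:].
(* The order induced on Reg A by that of [set (Tm A)], i.e. inclusion. *)
HB.instance Definition _ A := [SubChoice_isSubPOrder of Reg A by <: with set_display].

Lemma Reg_regular A (L : Reg A) : regular L.
Proof. by case: L => L /= /asboolP. Qed.

Lemma Reg_leE A (L L' : Reg A) : (L <= L')%O = (L `<=` L') :> Prop.
Proof. by rewrite -subsetEset. Qed.

(* L_A \ L_C and L_C / L_B; the usual notation leaves M implicit. *)
Definition left_residual A B C (M : Tm (Arr (Prod A B) C))
    (LA : set (Tm A)) (LC : set (Tm C)) : set (Tm B) :=
  [set NB | forall NA, LA NA -> LC (Tm_app M (Tm_pair NA NB))].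

Definition right_residual A B C (M : Tm (Arr (Prod A B) C))
    (LC : set (Tm C)) (LB : set (Tm B)) : set (Tm A) :=
  [set NA | forall NB, LB NB -> LC (Tm_app M (Tm_pair NA NB))].

(* f is left adjoint to g. *)
Definition adjunction d d' (P : porderType d) (P' : porderType d')
    (f : P -> P') (g : P' -> P) : Prop :=
  [/\ {homo f : x y / (x <= y)%O}, {homo g : x y / (x <= y)%O} &
      forall x y, (f x <= y)%O <-> (x <= g y)%O].

(* Main.v *)
Require Import Defs.
From mathcomp Require Import all_boot all_order.
From mathcomp Require Import boolp classical_sets.

(** If [LC] is recognized by [F] over [Q], then membership of [NB] in the left
    residual depends only on the [Q]-semantics of [NB], whatever [LA] is, so the
    same [Q] recognizes the residual. The adjunction is the Galois connection
    obtained by exchanging the two universal quantifiers. *)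

(** [Tm_app] is the class of an [App] of representatives, and the semantics is invariant under
    [conv], so the rest is computation. *)
Lemma Tm_sem_app (Q : finType) (A B : ty) (M : Tm (Arr A B)) (N : Tm A) :
  Tm_sem Q (Tm_app M N) =
  (Tm_sem Q M : {ffun ty_sem Q A -> ty_sem Q B}) (Tm_sem Q N).
Proof. exact: Tm_sem_pi. Qed.

Lemma Tm_sem_pair (Q : finType) (A B : ty) (M : Tm A) (N : Tm B) :
  Tm_sem Q (Tm_pair M N) = (Tm_sem Q M, Tm_sem Q N).
Proof. exact: Tm_sem_pi. Qed.

(** Since [ty_sem Q A] is finite, classical reflection turns any [Prop]-valued [P] into an accepting
    set. *)
Lemma Q_regular_saturated (Q : finType) (A : ty) (L : set (Tm A))
    (P : ty_sem Q A -> Prop) :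
  (forall N, L N <-> P (Tm_sem Q N)) -> Q_regular Q L.
Proof.
move=> LP; exists [set q | `[< P q >]]%SET.
apply/seteqP; split=> N /=; rewrite inE.
- by move=> /LP PN; apply/asboolP.
- by move=> /asboolP/LP.
Qed.

Lemma left_residual_regular (A B C : ty) (M : Tm (Arr (Prod A B) C))
    (LA : set (Tm A)) (LC : set (Tm C)) :
  regular LC -> regular (left_residual M LA LC).
Proof.
move=> [Q [F ->]]; exists Q.
(* The quantifier still ranges over terms of [LA]; only [NB] is abstracted to its value [b]. *)
apply: (@Q_regular_saturated _ _ _ (fun b => forall NA, LA NA ->
  (Tm_sem Q M : {ffun ty_sem Q A * ty_sem Q B -> ty_sem Q C})
    (Tm_sem Q NA, b) \in F)) => NB.
by split=> h NA /h /=; rewrite Tm_sem_app Tm_sem_pair.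
Qed.

Lemma right_residual_regular (A B C : ty) (M : Tm (Arr (Prod A B) C))
    (LC : set (Tm C)) (LB : set (Tm B)) :
  regular LC -> regular (right_residual M LC LB).
Proof.
move=> [Q [F ->]]; exists Q.
apply: (@Q_regular_saturated _ _ _ (fun a => forall NB, LB NB ->
  (Tm_sem Q M : {ffun ty_sem Q A * ty_sem Q B -> ty_sem Q C})
    (a, Tm_sem Q NB) \in F)) => NA.
by split=> h NB /h /=; rewrite Tm_sem_app Tm_sem_pair.
Qed.

Lemma residual_galois (A B C : ty) (M : Tm (Arr (Prod A B) C))
    (LA : set (Tm A)) (LB : set (Tm B)) (LC : set (Tm C)) :
  (LB `<=` left_residual M LA LC)%classic <->
  (LA `<=` right_residual M LC LB)%classic.
Proof. by split=> h N LN N' LN'; apply: h. Qed.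

Theorem theorem7p1 (A B C : ty) (M : Tm (Arr (Prod A B) C))
    (LC : set (Tm C)) (hLC : regular LC) :
  [/\ forall LA : set (Tm A), regular LA -> regular (left_residual M LA LC),
      forall LB : set (Tm B), regular LB -> regular (right_residual M LC LB)
    & exists (f : Reg A -> (Reg B)^d%type) (g : (Reg B)^d%type -> Reg A),
      [/\ forall LA : Reg A, lang (f LA) = left_residual M (lang LA) LC,
          forall LB : Reg B, lang (g LB) = right_residual M LC (lang LB),
          adjunction f g
        & forall (LA : Reg A) (LB : Reg B),
            (lang LB `<=` left_residual M (lang LA) LC)%classic <->
            (lang LA `<=` right_residual M LC (lang LB))%classic]].
Proof.
split=> [LA _|LB _|]; first exact: left_residual_regular.
  exact: right_residual_regular.
(* The dual has the same carrier as [Reg B]; only the order is reversed. *)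
pose f (LA : Reg A) : (Reg B)^d%type :=
  MkReg (asboolT (@left_residual_regular _ _ _ M (lang LA) LC hLC)).
pose g (LB : (Reg B)^d%type) : Reg A :=
  MkReg (asboolT (@right_residual_regular _ _ _ M LC (lang LB) hLC)).
exists f, g; split=> //; last by move=> LA LB; exact: residual_galois.
split.
(* A larger [LA] imposes more conditions on [NB], so the residual shrinks, which is monotonicity
   into the dual. *)
- move=> LA LA'; rewrite Order.DualPreorder.leEdual !Reg_leE => sLA NB h NA /sLA.
  exact: h.
- move=> LB LB'; rewrite Order.DualPreorder.leEdual !Reg_leE => sLB NA h NB /sLB.
  exact: h.
(* In the dual, [f LA <= LB] unfolds to the inclusion of [LB] in [f LA]. *)
- by move=> LA LB; rewrite Order.DualPreorder.leEdual !Reg_leE; exact: residual_galois.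
Qed.
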